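(* Let $L\subset\mathbb{Z}^n$ be a lattice, $\mu=\mu(I_L)$ and $\{B_1,\ldots,B_\mu\}$ a cardinality-minimal generating set of $I_L$. The multiset $\{\overline{F_{B_1}},\ldots,\overline{F_{B_\mu}}\}$ of equivalence classes of $I_L$-fibers is an invariant of $I_L$; that is, it is the same multiset for every cardinality-minimal generating set of $I_L$.
   Context: Let $\Bbbk$ be a field, $\mathbb{N}=\mathbb{Z}_{\ge0}$. A lattice is a subgroup $L\subset\mathbb{Z}^n$; its lattice ideal is $I_L=\langle x^u-x^v:u,v\in\mathbb{N}^n,\ u-v\in L\rangle\subset\Bbbk[x_1,\ldots,x_n]$. A binomial means a difference $x^u-x^v$ of two distinct monomials. A minimal generating set of $I_L$ is a set of binomials that is a minimal (under inclusion) system of generators of $I_L$; it is a cardinality-minimal generating set if it has the least cardinality among all minimal generating sets, and $\mu(I_L)$ denotes this least cardinality. An $I_L$-fiber is a set of the form $F_u=\{x^v:v\in\mathbb{N}^n,\ v-u\in L\}$ with $u\in\mathbb{N}^n$. For a binomial $B=x^u-x^v\in I_L$, $F_B:=F_u=F_v$. Fibers $F,G$ are equivalent if there are $u,v\in\mathbb{N}^n$ with $x^uF\subset G$ and $x^vG\subset F$; $\overline F$ denotes the equivalence class of $F$. *)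

(* Defs.v *)
From HB Require Import structures.
From mathcomp Require Import all_boot all_order all_algebra finmap multiset mpoly.
From mathcomp Require Import boolp classical_sets functions cardinality.

Set Implicit Arguments.
Unset Strict Implicit.
Unset Printing Implicit Defensive.

Import GRing.Theory.

Local Open Scope classical_set_scope.
Local Open Scope card_scope.
Local Open Scope ring_scope.

Definition ideal_gen (R : comNzRingType) (S : set R) : set R :=
  [set p | exists (r : nat) (a b : 'I_r -> R),
             (forall i, S (b i)) /\ p = \sum_(i < r) a i * b i].

(* Monomials x^u are identified with their exponents u : 'X_{1..n}; for a field
   k, 'X_[u] is the corresponding element of {mpoly k[n]}. *)
Definition exp_diff (n : nat) (u v : 'X_{1..n}) : 'rV[int]_n :=
  \row_i ((u i)%:Z - (v i)%:Z).

Definition lattice_ideal (k : fieldType) (n : nat) (L : {pred 'rV[int]_n}) :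
    set {mpoly k[n]} :=
  ideal_gen [set p : {mpoly k[n]} |
    exists u v : 'X_{1..n}, exp_diff u v \in L /\ p = 'X_[u] - 'X_[v]].

Definition is_binomial (k : fieldType) (n : nat) (p : {mpoly k[n]}) : Prop :=
  exists u v : 'X_{1..n}, u <> v /\ p = 'X_[u] - 'X_[v].

Definition minimal_generating_set (k : fieldType) (n : nat)
    (L : {pred 'rV[int]_n}) (S : set {mpoly k[n]}) : Prop :=
  [/\ S `<=` @is_binomial k n,
      ideal_gen S = lattice_ideal L
    & forall S' : set {mpoly k[n]},
        S' `<=` S -> ideal_gen S' = lattice_ideal L -> S' = S].

Definition cardinality_minimal_generating_set (k : fieldType) (n : nat)
    (L : {pred 'rV[int]_n}) (S : set {mpoly k[n]}) : Prop :=
  minimal_generating_set L S /\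
  forall S' : set {mpoly k[n]}, minimal_generating_set L S' -> S #<= S'.

Definition fiber (n : nat) (L : {pred 'rV[int]_n}) (u : 'X_{1..n}) :
    set 'X_{1..n} :=
  [set v | exp_diff v u \in L].

Definition is_fiber (n : nat) (L : {pred 'rV[int]_n}) (F : set 'X_{1..n}) :
    Prop :=
  exists u : 'X_{1..n}, F = fiber L u.

(* The product of monomials is the sum of exponents, so the image below is
   the set x^u F. *)
Definition equiv_fibers (n : nat) (F G : set 'X_{1..n}) : Prop :=
  exists u v : 'X_{1..n},
    [set (u + w)%MM | w in F] `<=` G /\ [set (v + w)%MM | w in G] `<=` F.

Definition fiber_class (n : nat) (L : {pred 'rV[int]_n})
    (F : set 'X_{1..n}) : set (set 'X_{1..n}) :=
  [set G | is_fiber L G /\ equiv_fibers F G].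

(* If B = x^u - x^v is a binomial of the lattice ideal, then u - v lies in L,
   and this union is the single fiber F_u = F_v: in characteristic different
   from 2 the pair (u, v) is determined by B, and in characteristic 2 it is
   determined up to order. *)
Definition binomial_fiber (k : fieldType) (n : nat) (L : {pred 'rV[int]_n})
    (B : {mpoly k[n]}) : set 'X_{1..n} :=
  [set w | exists u v : 'X_{1..n},
             [/\ u <> v, B = 'X_[u] - 'X_[v] & fiber L u w]].

Definition fiber_class_multiset (k : fieldType) (n : nat)
    (L : {pred 'rV[int]_n}) (S : {fset {mpoly k[n]}}) :
    {mset set (set 'X_{1..n})}%mset :=
  seq_mset [seq fiber_class L (binomial_fiber L B) | B <- enum_fset S].

(* Main.v *)
Require Import Defs.
From HB Require Import structures.
From mathcomp Require Import all_boot all_order all_algebra finmap multiset mpoly.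
From mathcomp Require Import boolp classical_sets functions cardinality.

(** Compare two fibers by [F <= G] when some translate of [F] lies in [G];
    fibers are equivalent exactly when they are comparable in both directions.

    The ring is graded by the fibers, and a binomial of the lattice ideal is
    homogeneous.  In an expression of a homogeneous binomial [t] through a
    binomial generating set, keeping only the terms of degree the fiber of [t]
    leaves multiples [x^w b] with [w + F_b] inside [F_t]: so [t] is generated
    by the generators whose fiber is below its own
    ([binomial_ideal_restrict], [generated_below]).

    Consequently the generators of one class can be traded between generating
    sets.  If [S] and [T] generate, so does the set obtained from [S] by
    replacing its elements of class [c] by those of [T]
    ([exchange_generates]): an element of [S] of class [c] is generated by the
    elements of [T] below it; those of class [c] were put in, and those of
    strictly smaller class are generated by elements of [S] of at most that
    class, which were not removed.

    A finite binomial generating set contains a minimal one, so a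
    cardinality-minimal [S] is no larger than any finite binomial generating
    set, in particular than the exchanged one.  Hence [S] has no more elements
    of class [c] than [T]; by symmetry the two numbers agree. *)

Set Implicit Arguments.
Unset Strict Implicit.
Unset Printing Implicit Defensive.

Import GRing.Theory.

Local Open Scope classical_set_scope.
Local Open Scope ring_scope.

(** * Generated ideals *)

Section IdealGen.
Variable R : comNzRingType.
Implicit Types (S T : set R) (p q : R).

Lemma ideal_gen0 S : ideal_gen S 0.
Proof. by exists 0%N, (fun=> 0), (fun=> 0); split=> [[]|] //; rewrite big_ord0. Qed.

Lemma ideal_genD S p q : ideal_gen S p -> ideal_gen S q -> ideal_gen S (p + q).
Proof.
move=> [r [a [b [Sb ->]]]] [s [c [d [Sd ->]]]].
exists (r + s)%N.
exists (fun i => match fintype.split i with inl j => a j | inr j => c j end).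
exists (fun i => match fintype.split i with inl j => b j | inr j => d j end).
split=> [i|]; first by case: fintype.split.
rewrite big_split_ord /=; congr (_ + _); apply: eq_bigr => i _.
  by case: split_ordP => j /eqP; rewrite ?eq_lshift ?eq_lrshift // => /eqP ->.
by case: split_ordP => j /eqP; rewrite ?eq_rshift ?eq_rlshift // => /eqP ->.
Qed.

Lemma ideal_genM S p q : ideal_gen S p -> ideal_gen S (q * p).
Proof.
move=> [r [a [b [Sb ->]]]]; exists r, (fun i => q * a i), b; split=> //.
by rewrite mulr_sumr; apply: eq_bigr => i _; rewrite mulrA.
Qed.

Lemma sub_ideal_gen S : S `<=` ideal_gen S.
Proof.
move=> p Sp; exists 1%N, (fun=> 1), (fun=> p); split=> //.
by rewrite big_ord1 mul1r.
Qed.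

Lemma ideal_gen_min S T : S `<=` ideal_gen T -> ideal_gen S `<=` ideal_gen T.
Proof.
move=> ST p [r [a [b [Sb ->]]]].
elim/big_ind: _ => [|x y|i _]; first exact: ideal_gen0.
  exact: ideal_genD.
by apply: ideal_genM; apply: ST.
Qed.

Lemma ideal_genS S T : S `<=` T -> ideal_gen S `<=` ideal_gen T.
Proof. by move=> ST; apply: ideal_gen_min => p /ST /sub_ideal_gen. Qed.

End IdealGen.

(** * Fibers and their classes *)

Definition fiber_le n (F G : set 'X_{1..n}) : Prop :=
  exists u : 'X_{1..n}, [set (u + w)%MM | w in F] `<=` G.

Lemma fiber_le_refl n (F : set 'X_{1..n}) : fiber_le F F.
Proof. by exists 0%MM => _ [w Fw <-]; rewrite add0m. Qed.

Lemma fiber_le_trans n (F G H : set 'X_{1..n}) :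
  fiber_le F G -> fiber_le G H -> fiber_le F H.
Proof.
move=> [u uFG] [v vGH]; exists (v + u)%MM => _ [w Fw <-].
by rewrite -addmA; apply: vGH; exists (u + w)%MM => //; apply: uFG; exists w.
Qed.

Lemma equiv_fibersP n (F G : set 'X_{1..n}) :
  equiv_fibers F G <-> fiber_le F G /\ fiber_le G F.
Proof.
split=> [[u [v [? ?]]]|[[u ?] [v ?]]]; last by exists u, v.
by split; [exists u | exists v].
Qed.

Lemma fiber_class_eq n (L : {pred 'rV[int]_n}) (F G : set 'X_{1..n}) :
  is_fiber L G ->
  fiber_class L F = fiber_class L G <-> fiber_le F G /\ fiber_le G F.
Proof.
move=> fG; split=> [FG|[FG GF]].
  have : fiber_class L G G.
    by split=> //; apply/equiv_fibersP; split; apply: fiber_le_refl.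
  by rewrite -FG => -[_ /equiv_fibersP].
apply/seteqP; split=> H [fH /equiv_fibersP [le ge]]; split=> //;
  apply/equiv_fibersP; split;
  by [apply: fiber_le_trans le | apply: fiber_le_trans ge _].
Qed.

Section Fibers.
Variables (n : nat) (L : {pred 'rV[int]_n}).
Hypothesis hL : zmod_closed L.
Implicit Types u v w m : 'X_{1..n}.

Lemma exp_diff_refl u : exp_diff u u \in L.
Proof.
suff -> : exp_diff u u = 0 by case: hL.
by apply/rowP => i; rewrite !mxE subrr.
Qed.

Lemma exp_diff_trans u v w :
  exp_diff u v \in L -> exp_diff w v \in L -> exp_diff u w \in L.
Proof.
move=> uv wv; suff -> : exp_diff u w = exp_diff u v - exp_diff w v.
  by case: hL => _; apply.
by apply/rowP => i; rewrite !mxE opprB addrA subrK.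
Qed.

Lemma exp_diff_sym u v : exp_diff u v \in L -> exp_diff v u \in L.
Proof. by move=> uv; apply: exp_diff_trans uv; apply: exp_diff_refl. Qed.

Lemma exp_diff_addl m u v : exp_diff (m + u) (m + v) = exp_diff u v.
Proof.
by apply/rowP => i; rewrite !mxE !mnmDE !PoszD opprD addrACA subrr add0r.
Qed.

Lemma fiber_self u : fiber L u u.
Proof. exact: exp_diff_refl. Qed.

Lemma fiber_eq u v : exp_diff u v \in L -> fiber L u = fiber L v.
Proof.
move=> uv; apply/seteqP; split=> w /= h.
  by apply: (exp_diff_trans h); apply: exp_diff_sym.
exact: (exp_diff_trans h).
Qed.

Lemma fiber_addl m u v w : exp_diff u v \in L ->
  fiber L w (m + u)%MM <-> fiber L w (m + v)%MM.
Proof.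
rewrite -(exp_diff_addl m) => uv; rewrite /fiber /=.
split=> h; last by apply: (exp_diff_trans uv); apply: exp_diff_sym.
exact: (exp_diff_trans (exp_diff_sym uv) (exp_diff_sym h)).
Qed.

Lemma fiber_le_addl m u w : fiber L w (m + u)%MM -> fiber_le (fiber L u) (fiber L w).
Proof.
move=> muw; exists m => _ [v uv <-].
by apply/(fiber_addl m w uv).
Qed.

(** A polynomial can be a difference of two distinct monomials in at most two
    ways, exchanging the monomials in characteristic 2; the fiber is unaffected
    as both monomials lie in it. *)
Lemma binomial_fiberE (k : fieldType) u v : u <> v -> exp_diff u v \in L ->
  binomial_fiber L ('X_[k, u] - 'X_[v]) = fiber L u.
Proof.
move=> uv uvL; apply/seteqP; split=> w; last by move=> ?; exists u, v.
move=> [u' [v' [/eqP uv' /mpolyP/(_ u') E]]].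
move: E; rewrite !mcoeffB !mcoeffX eqxx [v' == u']eq_sym (negPf uv') subr0.
case: (u =P u') => [<- //|_]; case: (v =P u') => [<- _|_ /eqP].
  by rewrite -(fiber_eq uvL).
by rewrite subr0 eq_sym oner_eq0.
Qed.

End Fibers.

(** * Homogeneous components of ideals of lattice binomials *)

Section Restrict.
Variables (k : fieldType) (n : nat) (L : {pred 'rV[int]_n}).
Hypothesis hL : zmod_closed L.
Implicit Types (S : set {mpoly k[n]}) (p : {mpoly k[n]}) (u v w m : 'X_{1..n}).

Definition restricts_to w p (g : {mpoly k[n]}) : Prop :=
  forall m, g@_m = if `[< fiber L w m >] then p@_m else 0.

(** In a multiple [x^m (x^u - x^v)] with [u - v] in the lattice, both monomials
    lie in the fiber of [w] or neither does; in the first case [m] translates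
    the fiber of [u] into that of [w].  Thus taking the component in degree the
    fiber of [w] keeps some of the terms of an expression and drops the
    others.  The case [u = v] is allowed so that the lemma also applies to the
    defining generators of the lattice ideal. *)
Lemma binomial_ideal_restrict S w p :
    (forall b, S b -> exists u v, exp_diff u v \in L /\ b = 'X_[u] - 'X_[v]) ->
    ideal_gen S p ->
  exists2 g, restricts_to w p g &
    ideal_gen [set b | S b /\ exists u v, [/\ exp_diff u v \in L,
      b = 'X_[u] - 'X_[v] & fiber_le (fiber L u) (fiber L w)]] g.
Proof.
move=> hS [r [a [b [Sb ->]]]]; set J := ideal_gen _.
pose Q p := exists2 g, restricts_to w p g & J g.
have Q0 : Q 0.
  by exists 0; [move=> m; rewrite mcoeff0 if_same | apply: ideal_gen0].
have QD x y : Q x -> Q y -> Q (x + y).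
  move=> [g gx Jg] [h hy Jh]; exists (g + h); last exact: ideal_genD.
  by move=> m; rewrite !mcoeffD gx hy; case: ifP; rewrite ?addr0.
rewrite -/(Q _); elim/big_ind: _ => // i _.
rewrite [a i]mpolyE mulr_suml; elim/big_ind: _ => // m _.
have [u [v [uvL Eb]]] := hS _ (Sb i).
have [mu|nmu] := pselect (fiber L w (m + u)%MM).
  exists (((a i)@_m *: 'X_[m]) * b i).
    move=> m'; case: asboolP => // nm'.
    rewrite -scalerAl mcoeffZ Eb mulrBr -!mpolyXD mcoeffB !mcoeffX.
    case: eqP => [mu'|_]; first by rewrite -mu' in nm'.
    case: eqP => [mv'|_]; last by rewrite subr0 mulr0.
    by case: nm'; rewrite -mv'; apply/(fiber_addl hL m w uvL).
  apply: ideal_genM; apply: sub_ideal_gen; split=> //; exists u, v; split=> //.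
  exact: (fiber_le_addl hL mu).
exists 0; last exact: ideal_gen0.
move=> m'; rewrite mcoeff0; case: asboolP => // wm'.
rewrite -scalerAl mcoeffZ Eb mulrBr -!mpolyXD mcoeffB !mcoeffX.
case: eqP => [mu'|_]; first by rewrite -mu' in wm'.
case: eqP => [mv'|_]; last by rewrite subr0 mulr0.
by case: nmu; apply/(fiber_addl hL m w uvL); rewrite mv'.
Qed.

(** Were [v] outside the fiber of [u], the component of [x^u - x^v] in degree
    that fiber would be the monomial [x^u]; but elements of the lattice ideal
    vanish at the point with all coordinates 1. *)
Lemma lattice_ideal_exp_diff u v :
  @lattice_ideal k n L ('X_[u] - 'X_[v]) -> exp_diff u v \in L.
Proof.
move=> Iuv; apply: contrapT => nuv.
have [b Sb|g gE Jg] := binomial_ideal_restrict u _ Iuv; first exact: Sb.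
have {gE} gX : g = 'X_[u].
  apply/mpolyP => m; rewrite gE mcoeffB !mcoeffX.
  case: asboolP => [um|num].
    case: (v =P m) => [vm|_]; last by rewrite subr0.
    by case: nuv; apply: (exp_diff_sym hL); rewrite vm.
  by case: eqP => // um; case: num; rewrite -um; apply: fiber_self.
have X1 m : ('X_[m] : {mpoly k[n]}).@[fun=> 1] = 1.
  by rewrite mevalX big1 // => i _; rewrite expr1n.
have : g.@[fun=> 1] = 0.
  case: Jg => r [a [b [hb ->]]].
  rewrite raddf_sum /= big1 // => i _; rewrite mevalM.
  case: (hb i) => _ [u' [v' [_ -> _]]].
  by rewrite mevalB !X1 subrr mulr0.
by rewrite gX X1 => /eqP; rewrite oner_eq0.
Qed.

Lemma lattice_binomialP (b : {mpoly k[n]}) : is_binomial b -> lattice_ideal L b ->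
  exists u v, [/\ b = 'X_[u] - 'X_[v], exp_diff u v \in L
                & binomial_fiber L b = fiber L u].
Proof.
move=> [u [v [uv ->]]] Ib; have uvL := lattice_ideal_exp_diff Ib.
by exists u, v; split=> //; apply: binomial_fiberE.
Qed.

Lemma is_fiber_binomial (b : {mpoly k[n]}) : is_binomial b -> lattice_ideal L b ->
  is_fiber L (binomial_fiber L b).
Proof. by move=> hb /(lattice_binomialP hb) [u [v [_ _ ->]]]; exists u. Qed.

Lemma generated_below S t :
    S `<=` @is_binomial k n -> ideal_gen S = lattice_ideal L ->
    is_binomial t -> lattice_ideal L t ->
  ideal_gen [set b | S b /\
    fiber_le (binomial_fiber L b) (binomial_fiber L t)] t.
Proof.
move=> binS genS bint It.
have [u [v [Et uvL ->]]] := lattice_binomialP bint It.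
have IS b : S b -> lattice_ideal L b by rewrite -genS; apply: sub_ideal_gen.
have hS b : S b -> exists u v, exp_diff u v \in L /\ b = 'X_[u] - 'X_[v].
  move=> Sb; have [u' [v' [-> ? _]]] := lattice_binomialP (binS _ Sb) (IS _ Sb).
  by exists u', v'.
have [|g gE Jg] := @binomial_ideal_restrict S u t hS; first by rewrite genS.
(* Both monomials of t lie in the fiber of u, so t is its own component. *)
have -> : t = g.
  apply/mpolyP => m; rewrite gE; case: asboolP => // num.
  rewrite Et mcoeffB !mcoeffX.
  case: eqP => [um|_]; first by case: num; rewrite -um; apply: fiber_self.
  case: eqP => [vm|_]; last by rewrite subr0.
  by case: num; rewrite -vm; apply: (exp_diff_sym hL).
apply: ideal_genS Jg => b [Sb [u' [v' [uvL' Eb le]]]]; split=> //.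
rewrite Eb binomial_fiberE // => uv'.
have [x [y [xy]]] := binS _ Sb.
rewrite Eb uv' subrr => /mpolyP/(_ x); rewrite mcoeff0 mcoeffB !mcoeffX eqxx.
by case: eqP => [/esym //|_] /eqP; rewrite subr0 eq_sym oner_eq0.
Qed.

End Restrict.

(** * Exchanging the generators of one class *)

Lemma card_filter_fset (K : choiceType) (P : pred K) (S : {fset K}) :
  #|` [fset b in S | P b]%fset| = count P (enum_fset S).
Proof.
rewrite -size_filter; apply/perm_size/uniq_perm; rewrite ?filter_uniq ?fset_uniq //.
by move=> b; rewrite mem_filter !inE andbC.
Qed.

Section Exchange.
Variables (k : fieldType) (n : nat) (L : {pred 'rV[int]_n}).
Hypothesis hL : zmod_closed L.
Implicit Types (S T : {fset {mpoly k[n]}}) (c : set (set 'X_{1..n})).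

Local Notation cls b := (fiber_class L (binomial_fiber L b)).

Definition exchange S T c : {fset {mpoly k[n]}} :=
  ([fset b in S | cls b != c] `|` [fset b in T | cls b == c])%fset.

Definition card_class S c : nat := count_mem c [seq cls b | b <- enum_fset S].

Lemma card_exchange S T c :
  (#|` exchange S T c| + card_class S c <= #|` S| + card_class T c)%N.
Proof.
rewrite /card_class !count_map.
have -> : #|` S| = (count (fun b => cls b != c) (enum_fset S)
                    + count (fun b => cls b == c) (enum_fset S))%N.
  by rewrite addnC -(count_predC (fun b => cls b == c)).
rewrite addnAC leq_add2r -!card_filter_fset.
by rewrite cardfsU leq_subr.
Qed.

(** An element [s] of [S] of class [c] was removed, but lies in the ideal of the
    generators [t] in [T] below it: either [t] has class [c] and was put in, or
    [t] lies in the ideal of the elements of [S] below [t], none of which has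
    class [c]. *)
Lemma exchange_generates S T c :
    [set` S] `<=` @is_binomial k n -> ideal_gen [set` S] = lattice_ideal L ->
    [set` T] `<=` @is_binomial k n -> ideal_gen [set` T] = lattice_ideal L ->
  ideal_gen [set` exchange S T c] = lattice_ideal L.
Proof.
move=> binS genS binT genT.
have IS b : b \in S -> lattice_ideal L b.
  by move=> ?; rewrite -genS; apply: sub_ideal_gen.
have IT b : b \in T -> lattice_ideal L b.
  by move=> ?; rewrite -genT; apply: sub_ideal_gen.
apply/seteqP; split.
  apply: ideal_gen_min => b /=.
  rewrite !inE /= => /orP [] /andP [bST _]; first exact: IS.
  exact: IT.
rewrite -genS; apply: ideal_gen_min => s /= sS.
have [sc|nsc] := eqVneq (cls s) c; last first.
  by apply: sub_ideal_gen; rewrite /= !inE sS nsc.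
have := generated_below hL binT genT (binS _ sS) (IS _ sS).
apply: ideal_gen_min => t [/= tT t_le_s].
have [tc|ntc] := eqVneq (cls t) c.
  by apply: sub_ideal_gen; rewrite /= !inE tT tc eqxx orbT.
have := generated_below hL binS genS (binT _ tT) (IT _ tT).
apply: ideal_genS => s' [/= s'S s'_le_t].
have fs := is_fiber_binomial hL (binS _ sS) (IS _ sS).
(* If s' were in c then s <= s' <= t <= s would put t in c too. *)
rewrite !inE s'S /=; apply/orP; left; apply/eqP => s'c.
have /(fiber_class_eq _ fs) [_ s_le_s'] : cls s' = cls s by rewrite s'c sc.
move/eqP: ntc; rewrite -sc; apply; apply/(fiber_class_eq _ fs).
by split=> //; apply: fiber_le_trans s'_le_t.
Qed.

(** Among the generating subsets of [T], one with the fewest elements is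
    minimal under inclusion, hence a competitor of [S]. *)
Lemma card_minimal_le S T :
    cardinality_minimal_generating_set L [set` S] ->
    [set` T] `<=` @is_binomial k n -> ideal_gen [set` T] = lattice_ideal L ->
  (#|` S| <= #|` T|)%N.
Proof.
move=> [_ minS] binT genT.
pose P m := `[< exists2 B : {fset {mpoly k[n]}}, (B `<=` T)%fset &
  ideal_gen [set` B] = lattice_ideal L /\ #|` B| = m >].
have exP : exists m, P m by exists #|` T|; apply/asboolP; exists T.
case: (ex_minnP exP) => m /asboolP [B BT [genB cB]] minm.
have minB : minimal_generating_set L [set` B].
  split=> // [b /(fsubsetP BT)|S' S'B genS']; first exact: binT.
  have /finite_fsetP [C S'C] := finite_subfset _ S'B.
  have CB : (C `<=` B)%fset.
    by apply/fsubsetP => x xC; apply: S'B; rewrite S'C.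
  suff -> : B = C by [].
  apply/esym/eqP; rewrite eqEfcard CB cB; apply: minm; apply/asboolP; exists C.
    exact: fsubset_trans BT.
  by rewrite -S'C.
apply: leq_trans (fsubset_leq_card BT).
rewrite -[X in #|` X|]set_fsetK; apply: geq_card_fset_set.
have /card_eqPle [Bn _] : ([set` B] #= `I_#|` B|)%card by apply/card_eq_fsetP.
exact: card_le_trans (minS _ minB) Bn.
Qed.

Lemma card_class_le S T c :
    cardinality_minimal_generating_set L [set` S] ->
    cardinality_minimal_generating_set L [set` T] ->
  (card_class S c <= card_class T c)%N.
Proof.
move=> cS [[binT genT _] _]; have [[binS genS _] _] := cS.
rewrite -(leq_add2l #|` S|); apply: leq_trans (card_exchange S T c).
rewrite leq_add2r.
apply: (card_minimal_le cS); last exact: exchange_generates.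
by move=> b /=; rewrite !inE => /orP [] /andP [bST _]; [apply: binS | apply: binT].
Qed.

End Exchange.

Theorem corollary4p15 (k : fieldType) (n : nat) (L : {pred 'rV[int]_n})
  (hL : zmod_closed L) (S T : {fset {mpoly k[n]}})
  (hS : cardinality_minimal_generating_set L [set` S])
  (hT : cardinality_minimal_generating_set L [set` T]) :
  fiber_class_multiset L S = fiber_class_multiset L T.
Proof.
apply/eq_seq_msetP/allP => c _ /=; rewrite eqn_leq.
by apply/andP; split; apply: card_class_le.
Qed.
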